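(* Let $X$ be an infinite, non-discrete Fréchet–Urysohn space. If $X$ is connected, then the hyperspace $\mathcal{S}_c(X)$ of nontrivial convergent sequences of $X$, with the Vietoris topology, is connected.
   Context: For a topological space $X$, $\mathcal{CL}(X)$ denotes the set of all nonempty closed subsets of $X$. For a nonempty family $\mathcal{U}$ of subsets of $X$, $\langle \mathcal{U}\rangle = \{F \in \mathcal{CL}(X) : F \subseteq \bigcup \mathcal{U} \text{ and } F \cap U \neq \emptyset \text{ for all } U \in \mathcal{U}\}$. The Vietoris topology on $\mathcal{CL}(X)$ has as a base the sets $\langle \mathcal{U}\rangle$, where $\mathcal{U}$ runs over all nonempty finite families of nonempty open subsets of $X$; every subset of $\mathcal{CL}(X)$ carries the subspace topology. A nontrivial convergent sequence of $X$ is a subset $S \subseteq X$ such that $|S| = \omega$ (countably infinite), $S$ has a unique non-isolated point $x_S$, and $S \setminus U$ is finite for each neighborhood $U$ of $x_S$. Then $\mathcal{S}_c(X) = \{S \in \mathcal{CL}(X) : S \text{ is a nontrivial convergent sequence}\}$. A space $X$ is Fréchet–Urysohn if whenever $A\subseteq X$ and $x \in \overline{A}$, there is a sequence of points of $A$ converging to $x$.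
   Formalization: The space X is additionally assumed to be T1 (points are closed); without a separation axiom the claim fails, e.g. for the disjoint sum of [0,1] and [2,3] with one extra point q added to every nonempty open set. *)

(* Defs.v *)
From HB Require Import structures.
From mathcomp Require Import all_boot all_order.
From mathcomp Require Import mathcomp_extra boolp classical_sets functions.
From mathcomp Require Import cardinality filter topology.

Set Implicit Arguments.
Unset Strict Implicit.
Unset Printing Implicit Defensive.

Local Open Scope classical_set_scope.

Record CL (X : topologicalType) := MkCL {
  CL_set :> set X;
  CL_closed : closed CL_set;
  CL_nonempty : CL_set !=set0
}.

HB.instance Definition _ (X : topologicalType) := gen_eqMixin (CL X).
HB.instance Definition _ (X : topologicalType) := gen_choiceMixin (CL X).

(** The set [<UU>] of the nonempty closed sets that are contained in the union
    of [UU] and meet every member of [UU]. *)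
Definition vietoris_cell (X : topologicalType) (UU : set (set X)) : set (CL X) :=
  [set F : CL X | F `<=` \bigcup_(U in UU) U /\
                  forall U, UU U -> F `&` U !=set0].

Definition vietoris_family (X : topologicalType) (UU : set (set X)) : Prop :=
  [/\ finite_set UU, UU !=set0 & forall U, UU U -> open U /\ U !=set0].

Lemma vietoris_cover (X : topologicalType) :
  \bigcup_(UU in @vietoris_family X) vietoris_cell UU = setT.
Proof.
rewrite predeqE => F; split=> // _; have [x Fx] := CL_nonempty F.
exists [set setT]; split.
- exact: finite_set1.
- by exists setT.
- by move=> _ ->; split; [exact: openT | exists x].
- by move=> y Fy; exists setT.
- by move=> _ ->; exists x.
Qed.

Lemma vietoris_join (X : topologicalType) (UU VV : set (set X)) (F : CL X) :
  vietoris_family UU -> vietoris_family VV ->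
  vietoris_cell UU F -> vietoris_cell VV F ->
  exists WW, [/\ vietoris_family WW, vietoris_cell WW F &
    vietoris_cell WW `<=` vietoris_cell UU `&` vietoris_cell VV].
Proof.
move=> [finU [U0 UU0] opU] [finV [V0 VV0] opV] [FU hitU] [FV hitV].
pose bU := \bigcup_(U in UU) U; pose bV := \bigcup_(V in VV) V.
have obU : open bU by apply: bigcup_open => U /opU [].
have obV : open bV by apply: bigcup_open => V /opV [].
pose WW := [set U `&` bV | U in UU] `|` [set V `&` bU | V in VV].
exists WW; split.
- split.
  + by rewrite finite_setU; split; exact: finite_image.
  + by exists (U0 `&` bV); left; exists U0.
  + move=> _ [[U UUU <-]|[V VVV <-]]; split.
    * by apply: openI => //; have [] := opU _ UUU.
    * by have [x [Fx Ux]] := hitU _ UUU; exists x; split=> //; exact: FV.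
    * by apply: openI => //; have [] := opV _ VVV.
    * by have [x [Fx Vx]] := hitV _ VVV; exists x; split=> //; exact: FU.
- split.
  + move=> x Fx; have [U UUU Ux] := FU _ Fx.
    by exists (U `&` bV); [left; exists U | split=> //; exact: FV].
  + move=> _ [[U UUU <-]|[V VVV <-]].
    * have [x [Fx Ux]] := hitU _ UUU; exists x; split=> //.
      by split=> //; exact: FV.
    * have [x [Fx Vx]] := hitV _ VVV; exists x; split=> //.
      by split=> //; exact: FU.
- move=> G [GW hitW]; split; split.
  + by move=> x /GW [_ [[U UUU <-] [Ux _]|[V _ <-] []//]]; exists U.
  + move=> U UUU; have [|x [Gx [Ux _]]] := hitW (U `&` bV).
      by left; exists U.
    by exists x.
  + by move=> x /GW [_ [[U _ <-] []//|[V VVV <-] [Vx _]]]; exists V.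
  + move=> V VVV; have [|x [Gx [Vx _]]] := hitW (V `&` bU).
      by right; exists V.
    by exists x.
Qed.

HB.instance Definition _ (X : topologicalType) :=
  isBaseTopological.Build (CL X) (@vietoris_cover X) (@vietoris_join X).

Lemma vietoris_openE (X : topologicalType) (A : set (CL X)) :
  open A <-> forall F, A F -> exists UU,
    [/\ vietoris_family UU, vietoris_cell UU F & vietoris_cell UU `<=` A].
Proof.
have opcell UU : vietoris_family UU -> open (vietoris_cell UU).
  move=> famUU; rewrite openE => F UUF; exists (vietoris_cell UU); split=> //.
  by exists [set UU]; [move=> _ -> | rewrite bigcup_set1].
split=> [|AP].
  rewrite openE => oA F /oA [_ [[D DP <-] [UU DUU UUF] sA]].
  exists UU; split=> //; first exact: DP.
  by move=> G UUG; apply: sA; exists UU.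
have -> : A = \bigcup_(UU in [set UU | vietoris_family UU /\
                                      vietoris_cell UU `<=` A]) vietoris_cell UU.
  rewrite predeqE => F; split=> [/AP [UU [? ? ?]]|[UU [_ sA] /sA//]].
  by exists UU.
by apply: bigcup_open => UU [/opcell].
Qed.

(** [isolated S] is the set of the isolated points of the subspace [S]. *)
Definition nontrivial_convergent_sequence (X : topologicalType) (S : set X) :
    Prop :=
  (S #= [set: nat])%card /\
  exists x, [/\ S `\` isolated S = [set x] &
                forall U, nbhs x U -> finite_set (S `\` U)].

Definition Sc (X : topologicalType) : set (CL X) :=
  [set S : CL X | nontrivial_convergent_sequence S].
Arguments Sc : clear implicits.

Definition frechet_urysohn (X : topologicalType) : Prop :=
  forall (A : set X) (x : X), closure A x ->
    exists2 u : nat -> X, (forall n, A (u n)) & u @ \oo --> x.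
Arguments frechet_urysohn : clear implicits.

Definition discrete_space (X : topologicalType) : Prop :=
  forall x : X, open [set x].
Arguments discrete_space : clear implicits.

(* Main.v *)
Require Import Defs.
From mathcomp Require Import all_boot all_order.
From mathcomp Require Import boolp classical_sets cardinality topology.

Local Open Scope classical_set_scope.

(** Let [S] and [T] be nontrivial convergent sequences, and let [b] be the limit
    of [T].  A basic neighbourhood of [S `|` [set b]], given by a finite family
    with union [V], only asks a closed set to lie in [V] and to meet each member
    of the family.  A finite subset [F] of [S `|` [set b]] already meets every
    member, and the tail [T `&` V] of [T] lies in [V]; hence [F `|` (T `&` V)]
    belongs to the neighbourhood.  So, up to adding and removing finitely many
    points, [T] comes arbitrarily close to [S].

    The connectedness of the space says that finitely many points do not
    matter: [y |-> S `|` [set y]] is a continuous map into the hyperspace, its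
    image is connected, and it contains [S] itself, as the value at a point of
    [S].  Therefore a relatively clopen set of sequences is invariant under the
    addition and the removal of finitely many points
    ([clopen_finite_modification]), and by the first paragraph it contains all
    sequences as soon as it contains one. *)

(** * Finite modifications of convergent sequences *)

(** In a T1 space this applies at every common point [p] of two sets with finite
    symmetric difference: that difference is closed and misses [p]. *)
Lemma isolated_local {X : topologicalType} {S T O : set X} {p : X} :
  nbhs p O -> O `&` S = O `&` T -> isolated S p -> isolated T p.
Proof.
move=> Op OST [/set_mem Sp [V Vp VS]]; split.
  have : (O `&` S) p by split=> //; exact: nbhs_singleton.
  by rewrite OST => -[_ ?]; rewrite inE.
exists (V `&` O); first exact: filterI.
rewrite -setIA -OST predeqE => q; split=> [[Vq [_ Sq]]|->].
  by rewrite -VS.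
by split; [exact: nbhs_singleton | split=> //; exact: nbhs_singleton].
Qed.

(** Finite sets being closed, the common points of [S] and [T] have
    neighbourhoods on which [S] and [T] coincide, and the finitely many points
    of [T] outside the closed set [S] are isolated in [T].  So [T] has the same
    non-isolated point as [S]. *)
Lemma nontrivial_convergent_almost_eq {X : topologicalType} {S T : set X}
    {x : X} :
  accessible_space X -> closed S ->
  (S #= [set: nat])%card ->
  S `\` isolated S = [set x] ->
  (forall U, nbhs x U -> finite_set (S `\` U)) ->
  finite_set (S `\` T) -> finite_set (T `\` S) -> T x ->
  nontrivial_convergent_sequence T.
Proof.
move=> XT1 cS cardS isoS convS finST finTS Tx.
have [Sx nisox] : (S `\` isolated S) x by rewrite isoS.
have commonE p : S p -> T p ->
    exists2 O, nbhs p O & O `&` S = O `&` T.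
  move=> Sp Tp; exists (~` ((S `\` T) `|` (T `\` S))).
    apply: open_nbhs_nbhs; split; last by move=> -[[]|[]].
    apply: closed_openC; move/accessible_finite_set_closed: XT1; apply.
    by rewrite finite_setU.
  rewrite predeqE => q; split=> -[nq mq]; split=> //; apply: contrapT => ?;
    by apply: nq; first [by left | by right].
split.
  apply: eq_card_nat.
    apply: (@sub_countable _ _ _ (\bigcup_(b in [set: bool])
      if b then S else T `\` S)).
      apply: subset_card_le => q Tq.
      by have [Sq|Sq] := pselect (S q); [exists true | exists false].
    apply: bigcup_countable => // -[] _; last exact: finite_set_countable.
    by rewrite (eq_countable cardS).
  move=> finT; apply: infinite_nat; rewrite -(eq_finite_set cardS).
  apply: (@sub_finite_set _ _ (T `|` (S `\` T))).
    by move=> q Sq; have [Tq|Tq] := pselect (T q); [left | right].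
  by rewrite finite_setU.
exists x; split; last first.
  move=> U /convS finSU; apply: (@sub_finite_set _ _ ((S `\` U) `|` (T `\` S))).
    by move=> q [Tq Uq]; have [Sq|Sq] := pselect (S q); [left | right].
  by rewrite finite_setU.
rewrite predeqE => p; split=> [[Tp nisop]|->].
  have [Sp|nSp] := pselect (S p).
    suff: (S `\` isolated S) p by rewrite isoS.
    split=> // isop; apply: nisop.
    have [O Op OE] := commonE p Sp Tp; exact: isolated_local Op OE isop.
  (* a point of [T `\` S] is isolated in [T], because [T `\` S] is finite *)
  exfalso; apply: nisop; split; first by rewrite inE.
  exists (~` S `&` ~` ((T `\` S) `\ p)).
    apply: filterI; apply: open_nbhs_nbhs; split=> //.
    - exact: closed_openC.
    - apply: closed_openC; move/accessible_finite_set_closed: XT1; apply.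
      exact: finite_setD.
    - by move=> [_] /(_ erefl).
  rewrite predeqE => q; split=> [[[nSq nq] Tq]|->].
    by apply: contrapT => qp; apply: nq.
  by split=> //; split=> // -[_] /(_ erefl).
split=> // isox; apply: nisox.
have [O Op OE] := commonE x Sx Tx.
exact: isolated_local Op (esym OE) isox.
Qed.

(** Since the tail contains the limit and the other points of [S] are isolated
    in [S], no point cut off is adherent to what remains. *)
Lemma closed_tail {X : topologicalType} {S V : set X} {x : X} :
  closed S -> S `\` isolated S = [set x] -> V x -> closed (S `&` V).
Proof.
move=> cS isoS Vx p clp.
have Sp : S p.
  by apply: cS => O /clp [q [[Sq _] Oq]]; exists q.
split=> //; have [->//|px] := pselect (p = x).
have [_ [O Op OS]] : isolated S p.
  by apply: contrapT => nisop; apply: px; have : (S `\` isolated S) p by [];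
    rewrite isoS.
have [q [[Sq Vq] Oq]] := clp _ Op.
by have : (O `&` S) q by []; rewrite OS => <-.
Qed.

(** * Adding one point *)

Lemma CL_inj {X : topologicalType} (F G : CL X) : CL_set F = CL_set G -> F = G.
Proof.
case: F G => [F cF F0] [G cG G0] /= FG; rewrite -FG in cG G0 *.
by congr MkCL; exact: Prop_irrelevance.
Qed.

Lemma setU1_nonempty {X : Type} {F : set X} {y : X} : F `|` [set y] !=set0.
Proof. by exists y; right. Qed.

Definition adjoin {X : topologicalType} (XT1 : accessible_space X) (F : CL X)
    (y : X) : CL X :=
  MkCL (@closedU _ _ _ (@CL_closed X F) (@accessible_closed_set1 X XT1 y))
    setU1_nonempty.

Lemma adjoin_id {X : topologicalType} (XT1 : accessible_space X) (F : CL X)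
    (y : X) : CL_set F y -> adjoin XT1 F y = F.
Proof.
by move=> Fy; apply: CL_inj => /=; apply/setUidPl => _ ->.
Qed.

Lemma adjoin_continuous {X : topologicalType} (XT1 : accessible_space X)
    (F : CL X) : continuous (adjoin XT1 F).
Proof.
apply/continuousP => A /vietoris_openE opA; rewrite openE => y /opA.
move=> [UU [[finU _ opU] [FyU hitU] sA]].
(* the members of [UU] that [F] misses are those that the new point must hit *)
pose O := \bigcup_(U in UU) U `&`
  ~` \bigcup_(U in [set U | UU U /\ ~ (CL_set F `&` U !=set0)]) ~` U.
have opO : open O.
  apply: openI; first by apply: bigcup_open => U /opU [].
  apply: closed_openC; apply: closed_bigcup.
    by apply: sub_finite_set finU => U [].
  by move=> U [/opU [oU _] _]; exact: open_closedC.
have Oy : O y.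
  split; first by apply: FyU; right.
  move=> [U [UUU nFU]]; apply; have [z [[Fz|->//] Uz]] := hitU _ UUU.
  by exfalso; apply: nFU; exists z.
apply: (@filterS _ _ _ O); last exact: open_nbhs_nbhs.
move=> z [zU nz]; apply: sA; split=> [q [Fq|->//]|U UUU].
  by apply: FyU; left.
have [[q [Fq Uq]]|nFU] := pselect (CL_set F `&` U !=set0).
  by exists q; split=> //; left.
exists z; split; first by right.
by apply: contrapT => nUz; apply: nz; exists U.
Qed.

Lemma Sc_adjoin {X : topologicalType} (XT1 : accessible_space X) {S : CL X}
    (y : X) : Sc X S -> Sc X (adjoin XT1 S y).
Proof.
move=> [cardS [x [isoS convS]]].
have [Sx _] : (S `\` isolated S) x by rewrite isoS.
apply: (nontrivial_convergent_almost_eq XT1 _ cardS isoS convS).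
- exact: CL_closed.
- by rewrite (_ : _ `\` _ = set0) // setD_eq0; exact: subsetUl.
- by apply: (@sub_finite_set _ _ [set y]) => // q [[]].
- by left.
Qed.

(** * Relatively clopen sets of convergent sequences *)

Section RelativelyClopen.
Variables (X : topologicalType) (XT1 : accessible_space X).
Hypothesis Xconn : connected [set: X].
Variables B C D : set (CL X).
Hypotheses (opC : open C) (clD : closed D).
Hypotheses (BC : B = Sc X `&` C) (BD : B = Sc X `&` D).

(** The set [P] of the points whose addition to [S] stays in [B] is clopen, and
    it is all of [X] once it is nonempty.  At a point [s] of [S] nothing is
    added, so membership at [s] and at [y] can be exchanged. *)
Lemma clopen_adjoin {S : CL X} (y : X) :
  Sc X S -> B (adjoin XT1 S y) <-> B S.
Proof.
move=> ScS; pose P := [set z | B (adjoin XT1 S z)].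
have PT z : P z -> P = setT.
  move=> Pz; apply: Xconn; first by exists z.
  - exists (adjoin XT1 S @^-1` C).
      by apply: open_comp => // ? _; exact: adjoin_continuous.
    rewrite setTI /P BC predeqE => w.
    by split=> [[]//|Cw]; split=> //; exact: Sc_adjoin.
  - exists (adjoin XT1 S @^-1` D).
      by apply: preimage_closed => // ? _; exact: adjoin_continuous.
    rewrite setTI /P BD predeqE => w.
    by split=> [[]//|Dw]; split=> //; exact: Sc_adjoin.
have [s Ss] := CL_nonempty S; split=> [/PT PE|BS].
  have : P s by rewrite PE.
  by rewrite /P/= adjoin_id.
have /PT PE : P s by rewrite /P/= adjoin_id.
by have : P y by rewrite PE.
Qed.

Lemma clopen_finite_modification {S T : CL X} {E : set X} :
  Sc X S -> finite_set E -> T = CL_set S `|` E :> set X -> B T <-> B S.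
Proof.
move=> ScS /finite_seqP [s ->]; elim: s S ScS => [|y s IHs] S ScS TE.
  suff -> : T = S by [].
  by apply: CL_inj; rewrite TE set_nil setU0.
rewrite -(clopen_adjoin y ScS); apply: IHs; first exact: Sc_adjoin.
rewrite TE /= predeqE => q; split=> [[|/=]|[[|->]|]].
- by left; left.
- by rewrite inE => /orP [/eqP ->|]; [left; right | right].
- by left.
- by right; rewrite /= inE eqxx.
- by move=> /= qs; right; rewrite /= inE qs orbT.
Qed.

(** The limit [b] of [T] is first adjoined to [S]: a neighbourhood of
    [S `|` [set b]] is then a neighbourhood of [b] as well, and leaves room for
    almost all of [T]. *)
Lemma clopen_all {S T : CL X} : B S -> Sc X T -> B T.
Proof.
move=> BS ScT; have ScS : Sc X S by move: BS; rewrite BC => -[].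
have [cardT [b [isoT convT]]] := ScT.
have [Tb _] : (T `\` isolated T) b by rewrite isoT.
have : B (adjoin XT1 S b) by apply/clopen_adjoin.
rewrite {1}BC => -[_ Cb]; have /vietoris_openE /(_ _ Cb) := opC.
move=> [UU [[finU _ opU] [SbV hitU] sC]].
set V := \bigcup_(U in UU) U in SbV.
have opV : open V by apply: bigcup_open => U /opU [].
have Vb : V b by apply: SbV; right.
have finTV : finite_set (T `\` V) by apply: convT; exact: open_nbhs_nbhs.
pose tail : CL X := MkCL (closed_tail (@CL_closed X T) isoT Vb)
  (ex_intro _ b (conj Tb Vb)).
have Sctail : Sc X tail.
  apply: (nontrivial_convergent_almost_eq XT1 _ cardT isoT convT) => //.
  - exact: CL_closed.
  - by apply: sub_finite_set finTV => q [Tq nq]; split=> // Vq; exact: nq.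
  - by rewrite (_ : _ `\` _ = set0) // setD_eq0 => q [].
(* the points [f U] make up the finite set [E] hitting every member of [UU];
   outside of [UU] the value [b] is a dummy *)
have /choice [f fP] : forall U, exists z,
    UU U -> (CL_set (adjoin XT1 S b) `&` U) z.
  move=> U; have [/hitU [z zP]|nU] := pselect (UU U); first by exists z.
  by exists b.
pose E := f @` UU.
have finE : finite_set E by exact: finite_image.
have clE : closed E by move/accessible_finite_set_closed: XT1; apply.
pose R : CL X := MkCL (@closedU _ _ _ (@CL_closed X tail) clE)
  (ex_intro _ b (or_introl (conj Tb Vb))).
have BR : B R -> B T.
  move/(clopen_finite_modification (T := R) Sctail finE erefl).
  move/(clopen_finite_modification (T := T) Sctail finTV); apply.
  by rewrite /= setUIDK.
apply: BR; rewrite BC; split; last first.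
  apply: sC; split=> [q [[]//|[U UUU <-]]|U UUU].
    by apply: SbV; case: (fP _ UUU).
  by exists (f U); split; [right; exists U | case: (fP _ UUU)].
apply: (nontrivial_convergent_almost_eq XT1 _ cardT isoT convT).
- exact: CL_closed.
- apply: sub_finite_set finTV => q [Tq nq]; split=> // Vq; apply: nq.
  by left.
- by apply: sub_finite_set finE => q [[[]|]].
- by left.
Qed.

End RelativelyClopen.

Theorem theorem2p2 (X : topologicalType) (XT1 : accessible_space X)
    (Xinfinite : infinite_set [set: X]) (Xnondiscrete : ~ discrete_space X)
    (XFU : frechet_urysohn X) (Xconnected : connected [set: X]) :
  connected (Sc X).
Proof.
move=> B [S BS] [C opC BC] [D clD BD].
rewrite predeqE => T; split=> [|ScT]; first by rewrite BC => -[].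
exact: (clopen_all X XT1 Xconnected B C D opC clD BC BD BS ScT).
Qed.
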